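(* Let $G$ be a connected planar graph of order $n \geq 2$, and for $i \in \{1,2\}$ let $n_i$ be the number of vertices of degree $i$ in $G$. Then $$ {}^{\partial}\gamma_{M}(G)\geq \max\left\{\frac{n-n_2-2n_1}{2}+1,\ 0\right\}.$$
   Context: All graphs are finite and simple (partial duals, however, may have loops or multiple edges). The order of a graph is its number of vertices. All embeddings are cellular. A planar graph $G$ is regarded as an embedded graph via an embedding on the sphere. Partial dual: Let $G$ be a graph cellularly embedded on an orientable surface, viewed as a ribbon graph (a thickened neighbourhood of $G$ consisting of vertex discs and edge ribbons), and let $A\subseteq E(G)$. The partial dual $G^A$ of $G$ with respect to $A$ (Chmutov) is the embedded graph (ribbon graph) obtained as follows: glue a disc to $G$ along each boundary component of the spanning ribbon subgraph $(V(G),A)$ (these discs are the vertex discs of $G^A$), and remove the interiors of all vertex discs of $G$; the edge ribbons are kept. In particular $G^{\emptyset}=G$ and $G^{E(G)}=G^*$, the geometric dual. Write $\gamma(G^A)$ for the genus of the (orientable) surface on which $G^A$ is cellularly embedded. Equivalently, for $G$ connected, $2-2\gamma(G^A)=f(A)-|E(G)|+f(E(G)\setminus A)$, where $f(B)$ is the number of boundary components of the spanning ribbon subgraph $(V(G),B)$. The maximum partial-dual genus of $G$ is ${}^{\partial}\gamma_M(G):=\max_{A\subseteq E(G)}\gamma(G^A)$. For a connected planar graph $G$ it is known that this value does not depend on the chosen embedding of $G$ on the sphere. *)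

(* Defs.v *)
From HB Require Import structures.
From mathcomp Require Import all_boot all_order all_algebra all_fingroup.

Set Implicit Arguments.
Unset Strict Implicit.
Unset Printing Implicit Defensive.

Record sgraph := SGraph {
  vertex :> finType;
  adj : rel vertex;
  adj_sym : symmetric adj;
  adj_irrefl : irreflexive adj }.

Definition connected_graph (G : sgraph) : Prop :=
  forall x y : G, connect (@adj G) x y.

Definition degree (G : sgraph) (x : G) : nat := #|[set y : G | adj x y]|.

Definition num_degree (G : sgraph) (i : nat) : nat :=
  #|[set x : G | degree x == i]|.

(** A graph cellularly embedded on a closed oriented surface, encoded as a
    combinatorial map. A dart is an edge end; [vperm] sends a dart to the next
    one counterclockwise around its vertex disc, and [eperm] exchanges the two
    ends of an edge. Vertices, edges and faces are permutation cycles, so loops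
    and multiple edges are allowed but isolated vertices are not representable
    (they occur neither in connected graphs of order at least 2 nor in partial
    duals of such graphs). *)
Record ribbon_graph := RibbonGraph {
  dart : finType;
  vperm : {perm dart};
  eperm : {perm dart};
  eperm_invol : involutive eperm;
  eperm_fixfree : forall d, eperm d != d }.

Definition edges (M : ribbon_graph) : {set {set dart M}} := porbits (eperm M).

Section SpanningSubgraph.

Variables (M : ribbon_graph) (A : {set {set dart M}}).

Definition cross_fun (d : dart M) : dart M :=
  if porbit (eperm M) d \in A then eperm M d else d.

Lemma cross_inj : injective cross_fun.
Proof.
have orb d : porbit (eperm M) (eperm M d) = porbit (eperm M) d.
  apply/eqP; rewrite eq_porbit_mem.
  by have := mem_porbit (eperm M) 1 d; rewrite expg1.
move=> x y; rewrite /cross_fun.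
case: ifP => hx; case: ifP => hy; [exact: perm_inj | | | by []].
- by move=> exy; rewrite -exy orb hx in hy.
- by move=> exy; rewrite exy orb hy in hx.
Qed.

(** The cycles of [boundary_perm M A] are the boundary components of the
    spanning ribbon subgraph with edge set [A]: following the boundary from an
    edge end [d], one goes along a side of the ribbon of [d] to its other end
    when this ribbon belongs to [A] (and passes by [d] otherwise), and then along
    the vertex disc to the next edge end. *)
Definition boundary_perm : {perm dart M} := (perm cross_inj * vperm M)%g.

(** The vertex discs of the partial dual are glued along the boundary components
    of the spanning subgraph [A]. Such a disc meets a ribbon outside [A] along
    its end [d], and a ribbon of [A] along the side followed from [d]; this
    arc becomes the end [d] of the same ribbon in the partial dual. *)
Definition partial_dual : ribbon_graph :=
  RibbonGraph boundary_perm (@eperm_invol M) (@eperm_fixfree M).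

End SpanningSubgraph.

Section Genus.

Variable M : ribbon_graph.

Definition num_vertices : nat := #|porbits (vperm M)|.
Definition num_edges : nat := #|edges M|.
Definition num_faces : nat := #|porbits (boundary_perm (edges M))|.

(** [connect] is symmetric for this relation because [vperm M] and [eperm M] are
    permutations of a finite type, hence [n_comp] counts components. *)
Definition num_components : nat :=
  n_comp [rel d d' : dart M | (d' == vperm M d) || (d' == eperm M d)] predT.

(** Total genus given by Euler's formula
      num_vertices - num_edges + num_faces = 2 num_components - 2 genus;
    the subtraction never truncates and the halved number is always even. *)
Definition genus : nat :=
  (num_components.*2 + num_edges - (num_vertices + num_faces))./2.

End Genus.

Definition max_pd_genus (M : ribbon_graph) : nat :=
  \max_(A : {set {set dart M}} | A \subset edges M) genus (partial_dual A).

Section Embedding.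

Variable G : sgraph.

Definition arc : finType := {p : G * G | adj p.1 p.2}.

Definition source (a : arc) : G := (val a).1.

Lemma arc_flipP (a : arc) : adj (val a).2 (val a).1.
Proof. by rewrite adj_sym (valP a). Qed.

Definition arc_flip (a : arc) : arc :=
  exist (fun p : G * G => adj p.1 p.2) ((val a).2, (val a).1) (arc_flipP a).

Lemma arc_flipK : involutive arc_flip.
Proof. by move=> a; apply: val_inj => /=; case: (val a). Qed.

Definition flip_perm : {perm arc} := perm (inv_inj arc_flipK).

Lemma flip_perm_invol : involutive flip_perm.
Proof. by move=> a; rewrite !permE arc_flipK. Qed.

Lemma flip_perm_fixfree (a : arc) : flip_perm a != a.
Proof.
apply/eqP; rewrite permE => /(congr1 source) /= ea.
have := valP a; rewrite /= -[X in adj _ X]/(source (arc_flip a)) ea.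
by rewrite -[(val a).1]/(source a) adj_irrefl.
Qed.

(** Cellular embeddings of [G] on oriented surfaces, as rotation systems: the
    arcs leaving each vertex form a single cycle of the rotation. *)
Record embedding := Embedding {
  rotation : {perm arc};
  rotationP : forall a b : arc,
    (b \in porbit rotation a) = (source a == source b) }.

Definition embedded (r : embedding) : ribbon_graph :=
  RibbonGraph (rotation r) flip_perm_invol flip_perm_fixfree.

End Embedding.

(* Main.v *)
Require Import Defs.
From mathcomp Require Import all_boot all_order all_algebra all_fingroup zify lra.
Import Order.TTheory GRing.Theory Num.Theory.
Local Open Scope ring_scope.

Set Implicit Arguments.
Unset Strict Implicit.
Unset Printing Implicit Defensive.

(** Write n for the order of G, E for its edge set, f(A) for the number of
    boundary components of the spanning ribbon subgraph with edge set A, and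
    r(A) for the graphic rank of A, realised as the dimension of the span of
    the vectors (x - y), for xy in A, in the space with basis V(G).

    Euler's formula for the partial dual gives
      2 - 2 genus(G^A) = f(A) - |E| + f(E \ A)
    (the faces of G^A are the boundary components of the complement of A:
    boundary_perm_dual). Adding a ribbon to A changes f by 1 up or down, and
    changes it down whenever it joins two components of (V, A); hence
      f(A) + 2 r(A) <= n + |A|          (boundary_count_le)
    and so genus(G^A) >= 1 + r(A) + r(E \ A) - n (genus_partial_dual_ge). It
    remains to split E into two parts of large total rank, that is, to find
    two disjoint forests with many edges.

    By the union theorem for submodular functions (submodular_split),
    some A has r(A) + r(E \ A) at least the minimum of |E \ X| + 2 r(X) over all
    sets X of edges. This minimum is at least half the sum S of min(3, deg x)
    over the vertices x (capped_degree_sum_le). Indeed, in a component of (V, X) with k vertices, X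
    accounts for at most k - 1 edges at a vertex, because G is simple, while the
    component contributes k - 1 to r(X) and
      k min(3, k - 1) <= 4 (k - 1).
    Since no vertex is isolated, S = 3n - n_2 - 2 n_1, and therefore
      2 genus(G^A) >= 2 + S - 2n = n - n_2 - 2 n_1 + 2. *)

(** * A union theorem for submodular functions *)

Section SubmodularSplit.
Local Open Scope nat_scope.

Variable T : finType.

Definition submodular (f : {set T} -> nat) :=
  forall X Y, f (X :|: Y) + f (X :&: Y) <= f X + f Y.

Lemma submodular_contract (f : {set T} -> nat) (e : T) :
  submodular f -> submodular (fun X => f (e |: X)).
Proof. by move=> sub X Y; rewrite setUUr setUIr sub. Qed.

(** The min-max formula for the rank of a matroid union, in the direction that
    produces a good partition. Induct on S: a point e may be assigned to either
    side, which contracts e in f or in g. If neither contraction keeps the bound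
    k, there are witnesses X and Y with values below k; uncrossing them,
    submodularity bounds the sum of the values of e |: X :|: Y and of X :&: Y by
    2k - 1, because e itself is counted once in S minus X :&: Y. *)
Lemma submodular_split (f g : {set T} -> nat) (k : nat) (S : {set T}) :
  submodular f -> submodular g ->
  (forall X : {set T}, X \subset S -> k <= #|S :\: X| + (f X + g X)) ->
  exists2 A : {set T}, A \subset S & k <= f A + g (S :\: A).
Proof.
elim: {S}#|S| {-2}S (erefl #|S|) f g => [|m IHm] S cardS f g subf subg bound.
  move/eqP: cardS; rewrite cards_eq0 => /eqP S0; subst S.
  exists set0; rewrite ?sub0set // set0D.
  by have := bound set0 (sub0set _); rewrite setD0 cards0.
have [e eS] : exists e, e \in S by apply/card_gt0P; rewrite cardS.
have [S' SS' eS'] : exists2 S', S = e |: S' & e \notin S'.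
  by exists (S :\ e); rewrite ?setD1K // !inE eqxx.
subst S; move: cardS; rewrite cardsU1 eS' add1n => -[cardS'].
have eA (A : {set T}) : A \subset S' -> e \notin A.
  by move=> /subsetP sA; apply: contra eS' => /sA.
have D1 (A : {set T}) : A \subset S' -> (e |: S') :\: A = e |: (S' :\: A).
  by move=> /eA eA'; apply/setP => x; rewrite !inE; case: eqP => // ->; rewrite eA'.
have D2 (A : {set T}) : (e |: S') :\: (e |: A) = S' :\: A.
  apply/setP => x; rewrite !inE; case: eqP => //= ->.
  by rewrite (negPf eS') andbF.
pose inf (X : {set T}) := #|S' :\: X| + (f (e |: X) + g X).
pose ing (X : {set T}) := #|S' :\: X| + (f X + g (e |: X)).
have [okf | /forallPn[X]] :=
    boolP [forall X : {set T}, (X \subset S') ==> (k <= inf X)].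
  have [|A sA kA] :=
    IHm S' cardS' (fun X => f (e |: X)) g (submodular_contract e subf) subg.
    by move=> Z sZ; exact: implyP (forallP okf Z) sZ.
  by exists (e |: A); rewrite ?setUS // D2.
have [okg | /forallPn[Y]] :=
    boolP [forall X : {set T}, (X \subset S') ==> (k <= ing X)].
  have [|A sA kA] :=
    IHm S' cardS' f (fun X => g (e |: X)) subf (submodular_contract e subg).
    by move=> Z sZ; exact: implyP (forallP okg Z) sZ.
  by exists A; rewrite ?D1 // (subset_trans sA) // subsetUr.
rewrite !negb_imply -!ltnNge => /andP[sY ltY] /andP[sX ltX]; exfalso.
have sXY : X :&: Y \subset S' by rewrite (subset_trans (subsetIl _ _)).
have sUXY : X :|: Y \subset S' by rewrite subUset sX.
(* The uncrossed sets violate the hypothesis of the induction. *)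
have b1 := bound _ (setUS [set e] sUXY).
have b2 := bound _ (subset_trans sXY (subsetUr [set e] S')).
rewrite D2 in b1; rewrite D1 // cardsU1 in b2.
have eD : e \notin S' :\: (X :&: Y) by rewrite inE (negPf eS') andbF.
rewrite eD in b2.
have cUI := cardsUI (S' :\: X) (S' :\: Y).
rewrite -setDIr -setDUr in cUI.
have sf := subf (e |: X) Y; have sg := subg X (e |: Y).
have eqf : (e |: X) :&: Y = X :&: Y.
  apply/setP => x; rewrite !inE; case: eqP => //= ->.
  by rewrite (negPf (eA _ sY)) andbF.
have eqg : X :&: (e |: Y) = X :&: Y.
  apply/setP => x; rewrite !inE; case: eqP => //= ->.
  by rewrite (negPf (eA _ sX)).
rewrite -setUA eqf in sf; rewrite setUCA eqg in sg.
rewrite /inf /ing in ltX ltY; lia.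
Qed.

End SubmodularSplit.

(** * Boundary components and partial duals *)

Section BoundaryComponents.

Variable M : ribbon_graph.

Lemma mem_porbit_eperm (d x : dart M) :
  (x \in porbit (eperm M) d) = (x == d) || (x == eperm M d).
Proof.
apply/idP/orP => [/porbitP[i ->] | [/eqP->|/eqP->]]; last 2 first.
- exact: porbit_id.
- by have := mem_porbit (eperm M) 1 d; rewrite expg1.
elim: i => [|i IHi]; first by left; rewrite expg0 perm1.
rewrite expgSr permM; case: IHi => /eqP->; first by right.
by left; rewrite eperm_invol.
Qed.

Lemma porbit_eperm (d : dart M) : porbit (eperm M) (eperm M d) = porbit (eperm M) d.
Proof. by apply/eqP; rewrite eq_porbit_mem mem_porbit_eperm eqxx orbT. Qed.

Lemma mem_edges (d : dart M) : porbit (eperm M) d \in edges M.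
Proof. exact: imset_f. Qed.

Lemma boundary_permE (A : {set {set dart M}}) (d : dart M) :
  boundary_perm A d = vperm M (if porbit (eperm M) d \in A then eperm M d else d).
Proof. by rewrite permM permE. Qed.

(** Inserting one ribbon is a multiplication by a transposition, so that it splits
    one boundary component or merges two. *)
Lemma boundary_permU1 (A : {set {set dart M}}) (d : dart M) :
  porbit (eperm M) d \notin A ->
  boundary_perm (porbit (eperm M) d |: A) =
  (tperm d (eperm M d) * boundary_perm A)%g.
Proof.
move=> dA; apply/permP => x; rewrite permM !boundary_permE in_setU1.
rewrite eq_porbit_mem mem_porbit_eperm.
case: tpermP => [->|->|/eqP nx /eqP ny]; rewrite ?eqxx ?orbT /=.
- by rewrite porbit_eperm (negPf dA).
- by rewrite (negPf dA) eperm_invol.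
- by rewrite (negPf nx) (negPf ny).
Qed.

Lemma boundary_perm0 : boundary_perm (set0 : {set {set dart M}}) = vperm M.
Proof. by apply/permP => x; rewrite boundary_permE inE. Qed.

(** A face of the partial dual goes to the other end of every ribbon, and the
    vertex discs of the dual go back along the ribbons of A, so that only the
    ribbons outside A are followed. *)
Lemma boundary_perm_dual (A : {set {set dart M}}) :
  boundary_perm (edges (partial_dual A)) =
  boundary_perm (edges M :\: A).
Proof.
apply/permP => x; rewrite permM permE /cross_fun imset_f //=.
rewrite !boundary_permE.
rewrite porbit_eperm eperm_invol inE mem_edges andbT.
by case: (_ \in A).
Qed.

Lemma num_components_gt0 : dart M -> (0 < num_components M)%N.
Proof.
move=> d; rewrite /num_components; set e := (X in n_comp X _).
(* Steps of a permutation can be reversed by iterating it. *)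
have sym_e : connect_sym e.
  move: (vperm M) (eperm M) @e => s t e.
  have inv (u : {perm dart M}) x : subrel (frel u) e -> connect e (u x) x.
    move=> sub_ue; have: fconnect u (u x) x.
      by rewrite fconnect_sym ?fconnect1 //; exact: perm_inj.
    by apply: connect_sub => y z /sub_ue/connect1.
  have half x y : connect e x y -> connect e y x.
    case/connectP => p; elim: p x => [|z p IHp] x /=; first by move=> _ ->.
    case/andP=> exz ep /(IHp _ ep) cyz; apply: connect_trans cyz _.
    case/orP: exz => /eqP->; apply: inv => a b /= /eqP <-;
    by rewrite /e /= eqxx ?orbT.
  by move=> x y; apply/idP/idP; apply: half.
apply/card_gt0P; exists (fingraph.root e d); by rewrite !inE roots_root.
Qed.

Lemma card_darts_of_edges (Y : {set {set dart M}}) : Y \subset edges M ->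
  #|[set d | porbit (eperm M) d \in Y]| = (#|Y|.*2)%N.
Proof.
move=> /subsetP sY; rewrite -sum1_card.
rewrite (partition_big (fun d => porbit (eperm M) d) (mem Y)) /=; last first.
  by move=> d; rewrite inE.
rewrite -muln2 -sum_nat_const; apply: eq_bigr => e /[dup] eY /sY /imsetP[d _ de].
subst e; transitivity #|[set d; eperm M d]|; last first.
  by rewrite cards2 eq_sym eperm_fixfree.
rewrite -sum1_card; apply: eq_bigl => x; rewrite !inE.
rewrite eq_porbit_mem mem_porbit_eperm andb_idl // => /pred2P[]->;
  by rewrite ?porbit_eperm.
Qed.

(** The map p assigns vectors to the darts; when it is constant on vertices and
    injective from vertices to a basis, the dimension of [edge_span A] is the
    graphic rank of A. *)
Section Span.

Variables (F : fieldType) (vT : vectType F) (p : dart M -> vT).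

Definition edge_span (A : {set {set dart M}}) : {vspace vT} :=
  (\sum_(d | porbit (eperm M) d \in A) <[p d - p (eperm M d)]>)%VS.

Lemma mem_edge_span (A : {set {set dart M}}) d :
  porbit (eperm M) d \in A -> p d - p (eperm M d) \in edge_span A.
Proof. by move=> dA; rewrite memvE; apply: (sumv_sup d). Qed.

Lemma edge_spanS (A B : {set {set dart M}}) :
  A \subset B -> (edge_span A <= edge_span B)%VS.
Proof.
move=> /subsetP sAB; apply/subv_sumP => d /sAB dB.
by rewrite -memvE mem_edge_span.
Qed.

(** Dimension is modular on subspaces, and the span sends unions to sums but
    intersections only into intersections. *)
Lemma edge_span_submodular :
  submodular (fun A : {set {set dart M}} => \dim (edge_span A)).
Proof.
move=> A B; rewrite -[leqRHS]dimv_sum_cap leq_add // dimvS //.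
  apply/subv_sumP => d; rewrite inE => /orP[] dAB; rewrite -memvE.
    by apply: (subvP (addvSl _ _)); rewrite mem_edge_span.
  by apply: (subvP (addvSr _ _)); rewrite mem_edge_span.
by rewrite subv_cap !edge_spanS ?subsetIl ?subsetIr.
Qed.

Hypothesis p_vperm : forall d, p (vperm M d) = p d.

(** Walking along a boundary component only changes vertex by crossing a ribbon
    of A, so darts of one boundary component lie in one component of A. *)
Lemma boundary_edge_span (A : {set {set dart M}}) x y :
  x \in porbit (boundary_perm A) y -> p y - p x \in edge_span A.
Proof.
case/porbitP => i ->; elim: i => [|i IHi]; first by rewrite expg0 perm1 subrr mem0v.
rewrite expgSr permM boundary_permE p_vperm.
set z := fun_of_perm (_ ^+ i)%g y in IHi *.
rewrite -(subrKA (p z)); apply: memvD => //.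
by case: ifP => zA; [exact: mem_edge_span | rewrite subrr mem0v].
Qed.

Lemma edge_spanU1 (A : {set {set dart M}}) d :
  (edge_span (porbit (eperm M) d |: A) <=
   edge_span A + <[p d - p (eperm M d)]>)%VS.
Proof.
apply/subv_sumP => x; rewrite in_setU1 eq_porbit_mem mem_porbit_eperm -memvE.
case/orP => [/pred2P[]->|xA]; last first.
- by apply: (subvP (addvSl _ _)); rewrite mem_edge_span.
- rewrite eperm_invol -opprB memvN.
  by apply: (subvP (addvSr _ _)); rewrite memv_line.
- by apply: (subvP (addvSr _ _)); rewrite memv_line.
Qed.

(** Euler's inequality V - E + F <= 2c for the ribbon subgraph A, where the rank
    stands for V - c. Adding a ribbon increases the rank only if its two ends lie
    on different boundary components, which it then merges. *)
Lemma boundary_count_le (A : {set {set dart M}}) : A \subset edges M ->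
  (#|porbits (boundary_perm A)| + (\dim (edge_span A)).*2
   <= num_vertices M + #|A|)%N.
Proof.
elim: {A}#|A| {-2}A (erefl #|A|) => [|m IHm] A cardA sA.
  move/eqP: cardA; rewrite cards_eq0 => /eqP->.
  rewrite boundary_perm0 cards0 /edge_span big1 ?dimv0 // => d.
  by rewrite inE.
have [e eA] : exists e, e \in A by apply/card_gt0P; rewrite cardA.
have [A' AA' eA'] : exists2 A', A = e |: A' & e \notin A'.
  by exists (A :\ e); rewrite ?setD1K // !inE eqxx.
move: cardA sA; rewrite AA' cardsU1 eA' add1n subUset sub1set => -[cardA'].
case/andP=> /imsetP[d _ de] /(IHm A' cardA'); rewrite cardA'; subst e => IH.
have := porbits_mul_tperm (boundary_perm A') d (eperm M d).
rewrite /= -boundary_permU1 // eq_sym eperm_fixfree.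
have dU := dimvS (edge_spanU1 A' d).
have [dd _] := dimv_add_leqif (edge_span A') <[p d - p (eperm M d)]>.
have [/boundary_edge_span din | _] := boolP (d \in _).
  have/addv_idPl eqU : (<[p d - p (eperm M d)]> <= edge_span A')%VS.
    by rewrite -memvE -opprB memvN.
  (* A boundary component is split, and the rank stays the same. *)
  rewrite addn0 addn1 => ->; rewrite addSn addnS ltnS.
  by apply: leq_trans IH; rewrite leq_add2l leq_double -[X in (_ <= \dim X)%N]eqU.
(* Two boundary components merge, and the rank grows by at most 1. *)
rewrite /= addn1 => cb; rewrite -(leq_add2r 2) addnAC cb addSn !addnS addn0 !ltnS.
rewrite -addn2; apply: leq_trans (leq_add IH (leqnn 2)).
rewrite -addnA leq_add2l addn2 -doubleS.
rewrite leq_double (leq_trans dU) // (leq_trans dd) // -addn1 leq_add2l.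
by rewrite dim_vline leq_b1.
Qed.

End Span.

End BoundaryComponents.

Lemma genus_partial_dual_ge (M : ribbon_graph) (F : fieldType) (vT : vectType F)
    (p : dart M -> vT) (A : {set {set dart M}}) :
  dart M -> (forall d, p (vperm M d) = p d) -> A \subset edges M ->
  (1 + (\dim (edge_span p A) + \dim (edge_span p (edges M :\: A)))
   <= genus (partial_dual A) + num_vertices M)%N.
Proof.
move=> d0 p_v sA.
have e1 := boundary_count_le p_v sA.
have e2 := boundary_count_le p_v (subsetDl (edges M) A).
have nc : (0 < num_components (partial_dual A))%N.
  exact: (@num_components_gt0 (partial_dual A) d0).
have cA : (#|A| + #|edges M :\: A| = #|edges M|)%N.
  by rewrite -(cardsID A (edges M)) (setIidPr sA).
have nf : num_faces (partial_dual A) = #|porbits (boundary_perm (edges M :\: A))|.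
  by rewrite /num_faces boundary_perm_dual.
rewrite /genus nf.
rewrite -[num_vertices (partial_dual A)]/#|porbits (boundary_perm A)|.
rewrite -[num_edges (partial_dual A)]/#|edges M|.
lia.
Qed.

(** * Rank and degrees in a simple graph *)

Section ComponentCount.

Variables (G : sgraph) (X : {set {set Defs.arc G}}).

Let edge_of (a : Defs.arc G) := porbit (flip_perm G) a.

Definition target (a : Defs.arc G) : G := source (arc_flip a).

Definition linked : rel G :=
  fun x y => [exists a : Defs.arc G,
    [&& source a == x, target a == y & edge_of a \in X]].

Lemma edge_of_flip a : edge_of (arc_flip a) = edge_of a.
Proof.
apply/eqP; rewrite eq_porbit_mem.
by have := mem_porbit (flip_perm G) 1 a; rewrite expg1 permE.
Qed.

Lemma linked_sym : connect_sym linked.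
Proof.
apply: sym_connect_sym => x y; apply/existsP/existsP => -[a /and3P[sa ta aX]];
by exists (arc_flip a); apply/and3P; rewrite /target arc_flipK edge_of_flip.
Qed.

Definition vertex_vector (x : G) : 'rV[rat]_#|G| := delta_mx 0 (enum_rank x).

Local Notation comp := (fingraph.root linked).

(** Modulo the span of X, each vertex equals the root of its component, so the
    roots span the quotient. *)
Lemma rank_components_ge (r : embedding G) :
  (#|G| <= \dim (@edge_span (embedded r) _ _ (vertex_vector \o @source G) X)
           + #|[set x | comp x == x]|)%N.
Proof.
set U := edge_span _ _; set R := [set x | _].
pose W := <<[seq vertex_vector x | x in R]>>%VS.
have connU x y : connect linked x y -> vertex_vector x - vertex_vector y \in U.
  case/connectP => p; elim: p x => [|z p IHp] x /=.
    by move=> _ ->; rewrite subrr mem0v.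
  case/andP=> /existsP[a /and3P[/eqP sa /eqP ta aX]] ep /(IHp _ ep) Uzy.
  rewrite -(subrKA (vertex_vector z)); apply: memvD => //.
  have := @mem_edge_span (embedded r) _ _ (vertex_vector \o @source G) X a aX.
  by rewrite /= permE -/(target a) sa ta.
have UWfull : (fullv <= U + W)%VS.
  apply/subvP => v _; rewrite [v]row_sum_delta; apply: memv_suml => i _.
  apply: memvZ; rewrite -[i]enum_valK -/(vertex_vector _).
  set x := enum_val i; rewrite -(subrK (vertex_vector (comp x)) (vertex_vector x)).
  apply: memv_add; first by rewrite connU // connect_root.
  apply: memv_span; apply/imageP; exists (comp x) => //.
  by rewrite inE; apply: (roots_root linked_sym).
have dim_full : \dim {:'rV[rat]_#|G|} = #|G|.
  by rewrite dimvf dim_matrix; exact: mul1n.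
rewrite -[leqLHS]dim_full; apply: leq_trans (dimvS UWfull) _.
apply: leq_trans (dimv_add_leqif _ _) _.
by rewrite leq_add2l (leq_trans (dim_span _)) // size_image.
Qed.

Definition arcs_at (x : G) := [set a : Defs.arc G | source a == x].

Lemma arc_inj (a b : Defs.arc G) : source a = source b -> target a = target b -> a = b.
Proof.
move=> s t; apply: val_inj; move: s t; rewrite /target /source.
by case: a b => [[x y] ?] [[x' y'] ?] /= -> ->.
Qed.

Lemma target_arcs_at x : {in arcs_at x &, injective target}.
Proof. by move=> a b; rewrite !inE => /eqP sa /eqP sb; apply: arc_inj; rewrite sa. Qed.

Lemma card_arcs_at x : #|arcs_at x| = degree x.
Proof.
rewrite -(card_in_imset (@target_arcs_at x)); apply: eq_card => y.
rewrite inE; apply/imsetP/idP => [[a ax ->] | xy].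
  by move: ax; rewrite inE => /eqP <-; exact: (valP a).
by exists (exist _ (x, y) xy); rewrite // inE.
Qed.

(** In a simple graph the arcs at x carried by X lead to distinct other vertices
    of the component of x. *)
Lemma degree_le_outside x :
  (degree x < #|[set a in arcs_at x | edge_of a \notin X]|
              + #|[set y | comp y == comp x]|)%N.
Proof.
rewrite -card_arcs_at -(cardsID [set a | edge_of a \notin X] (arcs_at x)).
rewrite -setIdE -addnS leq_add2l (cardsD1 x [set y | _]) inE eqxx add1n ltnS.
rewrite -(@card_in_imset _ _ target); last first.
  by apply: sub_in2 (@target_arcs_at x) => a /setDP[].
apply/subset_leq_card/subsetP => _ /imsetP[a + ->].
rewrite !inE negbK => /andP[aX /eqP sa]; apply/andP; split.
  apply: contraL (valP a) => /eqP ta.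
  by rewrite -[(val a).2]/(target a) ta -[(val a).1]/(source a) sa adj_irrefl.
rewrite (root_connect linked_sym) linked_sym connect1 //.
by apply/existsP; exists a; rewrite sa !eqxx.
Qed.

(** The value |E \ X| + 2 r(X) is compared with the capped degrees component by
    component: with k vertices, the component provides 4 (k - 1) on the right,
    and the degrees not accounted for by edges outside X cost at most
    k min(3, k - 1). *)
Lemma capped_degree_sum_le (r : embedding G) : X \subset edges (embedded r) ->
  (\sum_(x : G) minn 3 (degree x) <= #|edges (embedded r) :\: X|.*2
   + (\dim (@edge_span (embedded r) _ _ (vertex_vector \o @source G) X)).*2.*2)%N.
Proof.
move=> sX; have count := rank_components_ge r.
pose out x := #|[set a in arcs_at x | edge_of a \notin X]|.
have sum_out : (\sum_x out x = #|edges (embedded r) :\: X|.*2)%N.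
  rewrite -(@card_darts_of_edges (embedded r)) ?subsetDl // -sum1_card.
  rewrite (partition_big (@source G) predT) //=; apply: eq_bigr => x _.
  rewrite /out -sum1_card; apply: eq_bigl => a; rewrite !inE andbC.
  by rewrite (@mem_edges (embedded r)) andbT.
rewrite -sum_out -(leq_add2r #|[set x | comp x == x]|.*2.*2).
apply: (@leq_trans (\sum_x out x + #|G|.*2.*2)); last by lia.
have key c : comp c == c -> (\sum_(x | comp x == c) minn 3 (degree x) + 4
    <= \sum_(x | comp x == c) (out x + 4))%N.
  move=> /eqP cc; set k := #|[set x | comp x == c]|.
  have k_gt0 : (0 < k)%N by apply/card_gt0P; exists c; rewrite inE cc.
  have sum_const m : (\sum_(x | comp x == c) m = k * m)%N.
    by rewrite -sum_nat_const; apply: eq_bigl => x; rewrite inE.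
  have le_x : (\sum_(x | comp x == c) minn 3 (degree x)
     <= \sum_(x | comp x == c) (out x + minn 3 k.-1))%N.
    apply: leq_sum => x /eqP cx; have := degree_le_outside x.
    by rewrite cx -/k /out; lia.
  rewrite !big_split /= !sum_const in le_x *.
  have arith m : (0 < m)%N -> (m * minn 3 m.-1 + 4 <= m * 4)%N.
    case: m => [|[|[|[|m]]]] //= _; rewrite (minn_idPl _) //; lia.
  have := arith k k_gt0; lia.
have -> : (\sum_x out x + #|G|.*2.*2 = \sum_x (out x + 4))%N.
  by rewrite big_split /= sum_nat_const -!muln2 -mulnA.
have -> : (#|[set x | comp x == x]|.*2.*2 = \sum_(c | comp c == c) 4)%N.
  by rewrite sum_nat_cond_const -!muln2 -mulnA cardsE.
have comp_root x : xpredT x -> comp (comp x) == comp x.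
  by move=> _; apply: (roots_root linked_sym).
rewrite (partition_big comp (fun c => comp c == c)) //=.
rewrite [leqRHS](partition_big comp (fun c => comp c == c)) //=.
by rewrite -big_split; apply: leq_sum => c /key.
Qed.

End ComponentCount.

(** * The lower bound *)

Lemma num_vertices_embedded (G : sgraph) (r : embedding G) :
  (num_vertices (embedded r) <= #|G|)%N.
Proof.
have sub : porbits (rotation r) \subset [set arcs_at x | x in G].
  apply/subsetP => _ /imsetP[a _ ->].
  apply/imsetP; exists (source a) => //.
  by apply/setP => b; rewrite (rotationP r) inE eq_sym.
exact: leq_trans (subset_leq_card sub) (leq_imset_card _ _).
Qed.

Lemma degree_gt0 (G : sgraph) (x : G) :
  (2 <= #|G|)%N -> connected_graph G -> (0 < degree x)%N.
Proof.
move=> n2 conn; have [y yx] : exists y, y \in [set~ x].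
  by apply/card_gt0P; rewrite cardsC1; lia.
case/connectP: (conn x y) yx => [[|z p] /=].
  by move=> _ ->; rewrite !inE eqxx.
by case/andP=> xz _ _ _; apply/card_gt0P; exists z; rewrite inE.
Qed.

Lemma capped_degree_sum_eq (G : sgraph) : (forall x : G, 0 < degree x)%N ->
  (\sum_(x : G) minn 3 (degree x) + num_degree G 2 + (num_degree G 1).*2 = #|G| * 3)%N.
Proof.
move=> deg_gt0; have numE i : num_degree G i = (\sum_(x : G) (degree x == i))%N.
  by rewrite /num_degree -sum1dep_card big_mkcond; apply: eq_bigr => x _; case: eqP.
rewrite -addnn !numE -!big_split /= -sum_nat_const; apply: eq_bigr => x _.
by have := deg_gt0 x; case: (degree x) => [|[|[|d]]] //= _; lia.
Qed.

(** The two spanning subgraphs given by [submodular_split], with complementary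
    edge sets, have ranks summing to at least half of the capped degree sum; the
    doubled bound below avoids both division and subtraction. *)
Lemma max_pd_genus_ge (G : sgraph) (r : embedding G) :
  (2 <= #|G|)%N -> connected_graph G ->
  (#|G| + 2 <= (max_pd_genus (embedded r)).*2
               + num_degree G 2 + (num_degree G 1).*2)%N.
Proof.
move=> n2 conn; have deg_gt0 x := @degree_gt0 G x n2 conn.
have cappedE := capped_degree_sum_eq deg_gt0.
have [x _] : exists x : G, x \in G by apply/card_gt0P; apply: ltnW.
have [y] : exists y, y \in [set y | adj x y] by apply/card_gt0P; apply: deg_gt0.
rewrite inE => xy.
have d0 : dart (embedded r) by exact: (exist _ (x, y) xy : Defs.arc G).
pose p : dart (embedded r) -> 'rV[rat]_#|G| := @vertex_vector G \o @source G.
have p_vperm d : p (vperm (embedded r) d) = p d.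
  rewrite /p /=; congr vertex_vector; apply/eqP; rewrite eq_sym -(rotationP r).
  by have := mem_porbit (rotation r) 1 d; rewrite expg1.
pose s := (\sum_(x : G) minn 3 (degree x))%N.
have rank_sub : submodular (fun A => \dim (edge_span p A)) := edge_span_submodular p.
(* [uphalf] rounds half of the capped degree sum up, as the values compared with
   it are integers. *)
have [X sX|A sA kA] := submodular_split (k := uphalf s) (S := edges (embedded r))
  rank_sub rank_sub.
  by have := capped_degree_sum_le (r := r) sX; rewrite -/s -/p; lia.
have genusA := genus_partial_dual_ge d0 p_vperm sA.
have max_ge : (genus (partial_dual A) <= max_pd_genus (embedded r))%N.
  by rewrite /max_pd_genus (bigop.bigmax_sup A).
have vertices_le := num_vertices_embedded r.
rewrite -/s in cappedE.
lia.
Qed.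

Theorem theorem1p6 (G : sgraph) (r : embedding G) :
  (2 <= #|G|)%N ->
  connected_graph G ->
  genus (embedded r) = 0%N ->
  Num.max
    ((#|G|%:R - (num_degree G 2)%:R - 2%:R * (num_degree G 1)%:R) / 2%:R + 1)
    0
  <= (max_pd_genus (embedded r))%:R :> rat.
Proof.
move=> n2 conn _; rewrite ge_max ler0n andbT.
have := max_pd_genus_ge r n2 conn; rewrite -!muln2 -(ler_nat rat) !natrD !natrM.
lra.
Qed.
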